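(* Let $a<b$ be real numbers and let $\ell,n,r\in\overline{\mathbb N}_0$ with $1\le\ell,r\le n$. Then the set $\mathscr{F}_{\ell,r}^{n}[a,b]$ is a linear subspace of $C^{n}[a,b]$.
   Context: $\overline{\mathbb N}_0=\{0,1,2,\dots\}\cup\{\infty\}$. When an order equals $\infty$, the corresponding conditions are understood to hold for every finite derivative order. $C^n[a,b]$ denotes the real vector space of real-valued $n$-times continuously differentiable functions on $[a,b]$ (one-sided derivatives at endpoints). For $1\le\ell,r\le n$, $\mathscr{F}_{\ell,r}^{n}[a,b]$ is the set of functions $h\in C^n[a,b]$ with flat ends of orders $\ell$ and $r$, i.e. with $h^{(j)}(a)=0$ for $j=1,\dots,\ell$ and $h^{(k)}(b)=0$ for $k=1,\dots,r$. *)

(* Defs.v *)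
From HB Require Import structures.
From mathcomp Require Import all_boot all_order all_algebra.
From mathcomp Require Import all_classical all_reals all_analysis.

Set Implicit Arguments.
Unset Strict Implicit.
Unset Printing Implicit Defensive.

Import Order.TTheory GRing.Theory Num.Theory.
Import numFieldNormedType.Exports.

Local Open Scope classical_set_scope.
Local Open Scope ring_scope.

Variant enat := Fin of nat | Infty.

Coercion Fin : nat >-> enat.

Definition le_enat (m n : enat) : bool :=
  match m, n with
  | _, Infty => true
  | Infty, Fin _ => false
  | Fin i, Fin j => (i <= j)%N
  end.

Declare Scope enat_scope.
Delimit Scope enat_scope with enat.
Bind Scope enat_scope with enat.
Notation "m <= n" := (le_enat m n) : enat_scope.
Notation "m <= n <= p" := ((m <= n) && (n <= p))%enat : enat_scope.

(* The compact interval as a type, carrying the topology induced from R. In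
   that topology x^' only sees points of [a, b], so limits along x^' are
   one-sided at the endpoints. *)
Notation cint a b := (set_type `[a, b]%classic).

Section derivatives.
Context {R : realType} {a b : R}.
Implicit Types (f g : cint a b -> R) (x : cint a b).

Definition diff_quot f x : cint a b -> R :=
  fun y => (val y - val x)^-1 * (f y - f x).

Definition differentiable_at f x : Prop := cvg (diff_quot f x @ x^').

Definition deriv f : cint a b -> R := fun x => lim (diff_quot f x @ x^').

Definition derivs (k : nat) f : cint a b -> R := iter k deriv f.

Definition differentiable_upto (n : enat) f : Prop :=
  forall k : nat, (k.+1 <= n)%enat -> forall x, differentiable_at (derivs k f) x.

Definition is_Cn (n : enat) f : Prop :=
  differentiable_upto n f /\
  forall k : nat, (k <= n)%enat -> continuous (derivs k f).

End derivatives.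

Section Cn_closed.
Context {R : realType} {a b : R} (ab : a < b).
Implicit Types (f g : cint a b -> R) (x : cint a b).

Lemma cintP x : a <= val x <= b.
Proof. by have := valP x; rewrite inE /= in_itv. Qed.

Lemma mem_cint (t : R) : a <= t <= b -> t \in `[a, b]%classic.
Proof. by move=> tab; rewrite inE /= in_itv. Qed.

Lemma cint_dnbhs_proper x : ProperFilter x^'.
Proof.
apply: Build_ProperFilter_ex => A /nbhs_ballP[e /= e0 Ae].
have /andP[ax xb] := cintP x.
suff [t tab /andP[tx te]] :
    exists2 t : R, a <= t <= b & (t != val x) && (`|val x - t| < e).
  exists (Sub t (mem_cint tab)); apply: Ae; first by rewrite -initial_ballE.
  by apply: contraNneq tx => <-; rewrite SubK.
have e2 : 0 < e / 2 by rewrite divr_gt0.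
have e2e : e / 2 < e by rewrite ltr_pdivrMr// ltr_pMr// ltr1n.
have [xltb|blex] := ltP (val x) b.
- exists (Num.min b (val x + e / 2)).
    by rewrite ge_min lexx le_min (ltW ab) /= (le_trans ax)// lerDl ltW.
  have xm : val x < Num.min b (val x + e / 2) by rewrite lt_min xltb ltrDl.
  rewrite gt_eqF//= distrC gtr0_norm ?subr_gt0// (le_lt_trans _ e2e)//.
  by rewrite lerBlDl ge_min lexx orbT.
- have ltax : a < val x := lt_le_trans ab blex.
  exists (Num.max a (val x - e / 2)).
    by rewrite le_max lexx ge_max (ltW ab) /= (le_trans _ xb)// gerBl ltW.
  have mx : Num.max a (val x - e / 2) < val x.
    by rewrite gt_max ltax ltrBlDr ltrDl.
  rewrite lt_eqF//= gtr0_norm ?subr_gt0// (le_lt_trans _ e2e)//.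
  by rewrite lerBlDl -lerBlDr le_max lexx orbT.
Qed.

Let dnbhs_proper x : ProperFilter x^' := cint_dnbhs_proper x.
#[local] Existing Instance dnbhs_proper.

Lemma diff_quot_linear (c : R) f g x :
  diff_quot (c *: f + g) x = c *: diff_quot f x + diff_quot g x.
Proof.
apply/funext => y; rewrite /diff_quot !fctE /GRing.scale /=.
by rewrite opprD addrACA -mulrBr mulrDr mulrCA.
Qed.

Lemma differentiable_at_linear (c : R) f g x :
  differentiable_at f x -> differentiable_at g x ->
  differentiable_at (c *: f + g) x.
Proof.
move=> df dg; rewrite /differentiable_at diff_quot_linear.
by apply: is_cvgD => //; exact: is_cvgZl_tmp.
Qed.

Lemma deriv_linear (c : R) f g :
  (forall x, differentiable_at f x) -> (forall x, differentiable_at g x) ->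
  deriv (c *: f + g) = c *: deriv f + deriv g.
Proof.
move=> df dg; apply/funext => x; rewrite /deriv diff_quot_linear.
apply: (@cvg_lim R) => //.
by apply: cvgD; [apply: cvgZl_tmp; exact: df|exact: dg].
Qed.

Lemma derivs_linear (n : enat) (c : R) f g (k : nat) : (k <= n)%enat ->
  differentiable_upto n f -> differentiable_upto n g ->
  derivs k (c *: f + g) = c *: derivs k f + derivs k g.
Proof.
move=> + df dg; elim: k => // k IH kn.
have kn' : (k <= n)%enat by case: n kn {IH df dg} => //= m /ltnW.
by rewrite /derivs /= -!/(derivs k _) IH// deriv_linear//; [exact: df|exact: dg].
Qed.

Lemma diff_quot0 x : diff_quot (0 : cint a b -> R) x = cst 0.
Proof. by apply/funext => y; rewrite /diff_quot !fctE subrr mulr0. Qed.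

Lemma derivs0 (k : nat) : derivs k (0 : cint a b -> R) = 0.
Proof.
elim: k => // k IH; rewrite /derivs /= -/(derivs k _) IH.
apply/funext => x; rewrite /deriv diff_quot0.
by apply: (@cvg_lim R) => //; exact: cvg_cst.
Qed.

(* The proof of a < b is an argument because the vector space structure needs
   it: on a one-point interval x^' is not proper and limits are not unique. *)
Definition Cn_pred of a < b := fun n : enat =>
  (mem [set f : cint a b -> R | is_Cn n f] : {pred cint a b -> R}).

Lemma Cn_submod_closed n : submod_closed (Cn_pred ab n).
Proof.
split.
  rewrite inE /=; split=> k _ x; rewrite derivs0; last exact: (@cst_continuous _ R 0).
  by rewrite /differentiable_at diff_quot0; exact: is_cvg_cst.
move=> c f g; rewrite !inE /= => -[df cf] [dg cg]; split=> k kn x.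
  have kn' : (k <= n)%enat by case: n kn {df cf dg cg} => //= m /ltnW.
  rewrite (derivs_linear _ kn' df dg).
  by apply: differentiable_at_linear; [exact: df|exact: dg].
rewrite (derivs_linear _ kn df dg).
by apply: (@continuousD R); [apply: continuousZl_tmp; exact: cf|exact: cg].
Qed.

HB.instance Definition _ n :=
  GRing.isSubmodClosed.Build R (cint a b -> R) (Cn_pred ab n)
    (Cn_submod_closed n).

End Cn_closed.

Record Cn (R : realType) (a b : R) (ab : a < b) (n : enat) :=
  MkCn { Cn_fun :> cint a b -> R ; _ : Cn_fun \in Cn_pred ab n }.

Section Cn_lmodType.
Context (R : realType) (a b : R) (ab : a < b) (n : enat).

HB.instance Definition _ := [isSub for @Cn_fun R a b ab n].
HB.instance Definition _ := [Choice of Cn ab n by <:].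
HB.instance Definition _ := [SubChoice_isSubLmodule of Cn ab n by <:].

End Cn_lmodType.

Section flat_ends.
Context (R : realType) (a b : R) (ab : a < b).

Definition left_end : cint a b :=
  Sub a (mem_cint (introT andP (conj (lexx a) (ltW ab)))).
Definition right_end : cint a b :=
  Sub b (mem_cint (introT andP (conj (ltW ab) (lexx b)))).

Definition flat_ends (l r n : enat) : set (Cn ab n) :=
  [set h | (forall j : nat, (1%N <= j <= l)%enat -> derivs j h left_end = 0) /\
           (forall k : nat, (1%N <= k <= r)%enat -> derivs k h right_end = 0)].

End flat_ends.

Arguments flat_ends {R a b} ab l r n _.

(* Main.v *)
Require Import Defs.
From HB Require Import structures.
From mathcomp Require Import all_boot all_order all_algebra.
From mathcomp Require Import all_classical all_reals all_analysis.

(** Each flatness condition says that some functional [h |-> h^(j)(t)], with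
    [t] an endpoint and [1 <= j], vanishes at [h]. Since [l] and [r] are at most
    [n], every order [j] involved is at most [n], and on n-times continuously
    differentiable functions the j-th derivative is then a linear operator
    ([derivs_Cn_linear]). The functions with flat ends are thus an
    intersection of kernels of linear functionals. *)

Import Order.TTheory GRing.Theory Num.Theory.
Import numFieldNormedType.Exports.

Local Open Scope classical_set_scope.
Local Open Scope ring_scope.

Lemma le_enat_trans (m n p : enat) :
  (m <= n)%enat -> (n <= p)%enat -> (m <= p)%enat.
Proof. by case: m n p => [m|] [n|] [p|] //=; exact: leq_trans. Qed.

(** The bound [k <= n] supplies the existence of the limits of the difference
    quotients. The iterated derivative is total by convention, and it need not
    be additive where such limits fail to exist. *)
Lemma derivs_Cn_linear (R : realType) (a b : R) (ab : a < b) (n : enat)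
    (c : R) (f g : Cn ab n) (k : nat) (x : cint a b) : (k <= n)%enat ->
  derivs k (Cn_fun (c *: f + g)) x = c * derivs k f x + derivs k g x.
Proof.
move=> kn.
have /[!inE] -[df _] := valP f; have /[!inE] -[dg _] := valP g.
have -> : Cn_fun (c *: f + g) = c *: Cn_fun f + Cn_fun g.
  by rewrite -[LHS]/(val (c *: f + g)) linearP.
by rewrite (derivs_linear ab c kn df dg).
Qed.

Theorem theorem4 (R : realType) (a b : R) (ab : a < b) (l n r : enat)
    (hl : (1%N <= l <= n)%enat) (hr : (1%N <= r <= n)%enat) :
  submod_closed (mem (flat_ends ab l r n)).
Proof.
have /andP[_ ln] := hl; have /andP[_ rn] := hr.
split=> [|c f g].
  have val0 : (0 : Cn ab n) = 0 :> (cint a b -> R).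
    by rewrite -[LHS]/(val 0) linear0.
  by rewrite inE; split=> k _; rewrite val0 (derivs0 ab).
rewrite !inE => -[fa fb] [ga gb]; split=> k /[dup] kle /andP[_ kn].
- have {}kn := le_enat_trans _ _ _ kn ln.
  by rewrite derivs_Cn_linear// fa// ga// mulr0 addr0.
- have {}kn := le_enat_trans _ _ _ kn rn.
  by rewrite derivs_Cn_linear// fb// gb// mulr0 addr0.
Qed.
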